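(* Assume the setting described in the context, with bounded measurable drifts $b_+,b_-$, and suppose there are constants $r_+>0$, $r_->0$ such that for all $x\in\mathbb R$ $$b_+(x)\ge r_+,\qquad b_-(x)\ge -r_-,\qquad\text{and}\qquad \frac{r_+}{\lambda_+}>\frac{r_-}{\lambda_-}.$$ Then $X_t\to+\infty$ almost surely as $t\to\infty$. Moreover, there is a constant $c_0>0$ such that $$\liminf_{t\to\infty}\frac{X_t}{t}\ge c_0\quad\text{a.s.},$$ and there is a constant $c_0>0$ such that for every $\epsilon>0$ there exist $\kappa\in(0,1)$ and $t_0=t_0(\kappa,\epsilon)$ with $$\mathbb P_x\Big(\frac{X_t-x}{t}-c_0<-\epsilon\Big)<\kappa^{t}\qquad\text{for all } t\ge t_0 .$$
   Context: Let $(\Omega,\mathcal F,(\mathcal F_t),\mathbb P)$ be a filtered probability space carrying a one-dimensional standard Wiener process $W$ and, independent of $W$, a continuous-time Markov chain $Z=(Z_t)_{t\ge0}$ with right-continuous paths taking values in $\{0,1\}$; $\mathcal F_t$ is generated by $W$ and $Z$ up to time $t$. State $1$ is the ''$+$'' regime and state $0$ the ''$-$'' regime: the chain leaves state $1$ with constant rate $\lambda_+>0$ and leaves state $0$ with constant rate $\lambda_->0$ (so sojourn times are independent exponential variables with these parameters). Let $b_+,b_-:\mathbb R\to\mathbb R$ be Borel measurable with $\sup_x|b_\pm(x)|<\infty$, and set $b(x,1)=b_+(x)$, $b(x,0)=b_-(x)$. The process $X$ is the unique strong solution of $$dX_t=b(X_t,Z_t)\,dt+dW_t,\qquad X_0=x\in\mathbb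 R,\ Z_0=z\in\{0,1\};$$ $\mathbb P_x,\mathbb E_x$ denote probability and expectation for this process started at $X_0=x$. *)

(* Defs.v *)
From HB Require Import structures.
From mathcomp Require Import all_boot all_order all_algebra.
From mathcomp Require Import all_classical all_reals all_analysis.
Set Implicit Arguments. Unset Strict Implicit. Unset Printing Implicit Defensive.
Import Order.TTheory GRing.Theory Num.Theory.
Import numFieldNormedType.Exports.
Local Open Scope classical_set_scope.
Local Open Scope ring_scope.

(* Regime: true = "+" (state 1), false = "-" (state 0). *)
Definition drift {R : realType} (bp bm : R -> R) (x : R) (s : bool) : R :=
  if s then bp x else bm x.

Definition leave_rate {R : realType} (lp lm : R) (s : bool) : R :=
  if s then lp else lm.

(* Regime during the k-th sojourn (k = 0, 1, ...) when Z_0 = z: regimes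
   alternate since the chain has two states. *)
Definition sojourn_state (z : bool) (k : nat) : bool :=
  if odd k then ~~ z else z.

Definition jump_time {R : realType} (Omega : Type) (tau : nat -> Omega -> R)
  (k : nat) (w : Omega) : R := \sum_(j < k) tau j w.

Definition mutual_indep {d : measure_display} {Omega : measurableType d}
  {R : realType} (P : probability Omega R) (n : nat) (Y : 'I_n -> Omega -> R) :=
  forall B : 'I_n -> set R, (forall i, measurable (B i)) ->
    P (\bigcap_(i in [set: 'I_n]) (Y i @^-1` B i)) =
    (\prod_(i < n) P (Y i @^-1` B i))%E.

(* W is a standard Wiener process (W_0 = 0, continuous paths, independent
   centred Gaussian increments of variance t - s) and, independently of W,
   tau_0, tau_1, ... are independent sojourn times, tau_k exponential with
   the leaving rate of the regime occupied during the k-th sojourn.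
   Stated through the joint law of any finite family of increments of W
   and of sojourn times. *)
Definition wiener_and_sojourns {d : measure_display} {Omega : measurableType d}
  {R : realType} (P : probability Omega R) (W : R -> Omega -> R)
  (tau : nat -> Omega -> R) (z : bool) (lp lm : R) : Prop :=
  [/\ (forall w, W 0 w = 0),
      (forall w, continuous (fun t => W t w)),
      (forall t, measurable_fun setT (W t)),
      (forall k, measurable_fun setT (tau k)) &
      forall (n m : nat) (t : nat -> R), t 0%N = 0 ->
        (forall i, (i < n)%N -> t i < t i.+1) ->
        [/\ mutual_indep P (fun i : 'I_(n + m) =>
               match fintype.split i with
               | inl j => fun w => W (t j.+1) w - W (t j) w
               | inr k => tau k
               end),
            (forall (j : 'I_n) (B : set R), measurable B ->
               P ((fun w => W (t j.+1) w - W (t j) w) @^-1` B) =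
               normal_prob 0 (Num.sqrt (t j.+1 - t j)) B) &
            (forall (k : 'I_m) (B : set R), measurable B ->
               P (tau k @^-1` B) =
               exponential_prob (leave_rate lp lm (sojourn_state z k)) B)]].

Definition chain_from_sojourns {R : realType} (Omega : Type)
  (tau : nat -> Omega -> R) (z : bool) (Z : R -> Omega -> bool) : Prop :=
  forall w k t, jump_time tau k w <= t < jump_time tau k.+1 w ->
    Z t w = sojourn_state z k.

Definition solves_sde {d : measure_display} {Omega : measurableType d}
  {R : realType} (P : probability Omega R) (bp bm : R -> R)
  (W : R -> Omega -> R) (Z : R -> Omega -> bool) (X : R -> Omega -> R)
  (x : R) : Prop :=
  (forall t, measurable_fun setT (X t)) /\
  {ae P, forall w : Omega, forall t : R, 0 <= t ->
     measurable_fun `[0, t] (fun s : R => drift bp bm (X s w) (Z s w)) /\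
     X t w = x + Rintegral lebesgue_measure `[0, t]
                   (fun s : R => drift bp bm (X s w) (Z s w)) + W t w}.

(* Main.v *)
Require Import Defs.
From HB Require Import structures.
From mathcomp Require Import all_boot all_order all_algebra.
From mathcomp Require Import all_classical all_reals all_analysis.
From mathcomp Require Import measurable_realfun ring lra.
Import Order.TTheory GRing.Theory Num.Theory.
Import numFieldNormedType.Exports.
Local Open Scope classical_set_scope.
Local Open Scope ring_scope.

(* Fix c > 0 so small that (rp - c) / lp > (rm + c) / lm. Along a path, the drift
   integral minus c t is at least the piecewise linear function of t with slope
   rp - c in regime + and - (rm + c) in regime -, whose value S_k at the k-th
   jump time is a sum of independent terms. Chernoff's bound for exponential
   variables gives P(S_k < del k) <= C r^k with r < 1; if S_k >= del k for all
   k >= m, then the chain does not explode and the drift integral is at least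
   c t for all t past the m-th jump, and with m proportional to t the m-th jump
   occurs before t up to an exponentially small probability. Gaussian tails
   bound P(W_t < - c t / 2), and Borel-Cantelli together with dyadic chaining
   gives W_t = o(t) almost surely, so that c0 = c / 2 works throughout. *)

(** * Integrals determined by their values on indicators; expectations of products of independent
    variables *)

Section eq_integral.
Local Open Scope ereal_scope.
Import HBNNSimple.

Lemma ge0_integral_comp_nnsfun (R : realType) (d : measure_display)
    (T : measurableType d) (m : {measure set T -> \bar R})
    (F Y : T -> R) (h : {nnsfun R >-> R}) :
  measurable_fun setT F -> (forall x, 0 <= F x)%R -> measurable_fun setT Y ->
  \int[m]_x (F x * h (Y x))%:E =
  \sum_(y \in range h) (y%:E * \int[m]_x (F x * \1_(h @^-1` [set y]) (Y x))%:E).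
Proof.
move=> mF F0 mY.
have mI y : measurable_fun setT
    (fun x => (F x * \1_(h @^-1` [set y]) (Y x))%:E).
  by apply/measurable_EFinP; apply: measurable_funM => //; exact: measurableT_comp.
transitivity (\int[m]_x \sum_(y \in range h)
    (y%:E * (F x * \1_(h @^-1` [set y]) (Y x))%:E)).
  apply: eq_integral => x _; rewrite (fimfunE h) EFinM -fsumEFin//.
  rewrite ge0_mule_fsumr; last first.
    by move=> y; rewrite EFinM; exact: nnfun_muleindic_ge0.
  by apply: eq_fsbigr => y _; rewrite !EFinM muleCA.
have hy0 y x : 0 <= y%:E * (F x * \1_(h @^-1` [set y]) (Y x))%:E.
  by rewrite EFinM muleCA mule_ge0 ?lee_fin//; exact: nnfun_muleindic_ge0.
rewrite ge0_integral_fsum//; last by move=> y; apply: measurable_funeM.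
apply: eq_fsbigr => y /set_mem[x _ <-].
rewrite ge0_integralZl//; first by move=> t _; rewrite lee_fin mulr_ge0.
by rewrite lee_fin.
Qed.

(** Linearity extends the equality from indicators to simple functions, and monotone convergence to
    all nonnegative measurable [f]. The weights [F1] and [F2] serve two purposes: a density on the
    line, and the product of the remaining factors in an independent family. *)
Lemma eq_integral_indic_ge0 (R : realType) (d1 d2 : measure_display)
    (T1 : measurableType d1) (T2 : measurableType d2)
    (m1 : {measure set T1 -> \bar R}) (m2 : {measure set T2 -> \bar R})
    (F1 Y1 : T1 -> R) (F2 Y2 : T2 -> R) (f : R -> R) :
  measurable_fun setT F1 -> (forall x, 0 <= F1 x)%R -> measurable_fun setT Y1 ->
  measurable_fun setT F2 -> (forall x, 0 <= F2 x)%R -> measurable_fun setT Y2 ->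
  (forall B : set R, measurable B ->
    \int[m1]_x (F1 x * \1_B (Y1 x))%:E = \int[m2]_x (F2 x * \1_B (Y2 x))%:E) ->
  measurable_fun setT f -> (forall y, 0 <= f y)%R ->
  \int[m1]_x (F1 x * f (Y1 x))%:E = \int[m2]_x (F2 x * f (Y2 x))%:E.
Proof.
move=> mF1 F10 mY1 mF2 F20 mY2 E12 mf f0.
have mEf : measurable_fun [set: R] (EFin \o f) by exact/measurable_EFinP.
pose h := nnsfun_approx measurableT mEf.
have approx (d : measure_display) (T : measurableType d)
    (m : {measure set T -> \bar R}) (F Y : T -> R) :
    measurable_fun setT F -> (forall x, 0 <= F x)%R -> measurable_fun setT Y ->
    \int[m]_x (F x * f (Y x))%:E = limn (fun n => \int[m]_x (F x * h n (Y x))%:E).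
  move=> mF F0 mY; rewrite -monotone_convergence//.
  - apply: eq_integral => x _; apply/esym/cvg_lim => //.
    under eq_fun do rewrite EFinM.
    rewrite EFinM; apply: cvgeZl => //.
    by apply: (cvg_nnsfun_approx measurableT mEf) => // y _; rewrite lee_fin.
  - move=> n; apply/measurable_EFinP; apply: measurable_funM => //.
    exact: measurableT_comp.
  - by move=> n x _; rewrite lee_fin mulr_ge0.
  - move=> x _ a b ab; rewrite lee_fin ler_wpM2l//.
    by have /lefP := nd_nnsfun_approx measurableT mEf ab; exact.
rewrite !approx//; congr (limn _); apply/funext => n.
rewrite !ge0_integral_comp_nnsfun//; apply: eq_fsbigr => y _.
by rewrite E12.
Qed.

End eq_integral.

(* The indicator factors are replaced by the [f i] one index at a time: [k]
   counts the indices that have already been replaced. *)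
Lemma mutual_indep_expectation (R : realType) (d : measure_display)
    (Omega : measurableType d) (P : probability Omega R) (n : nat)
    (Y : 'I_n -> Omega -> R) (f : 'I_n -> R -> R) (c : 'I_n -> R) :
  (forall i, measurable_fun setT (Y i)) -> mutual_indep P Y ->
  (forall i, measurable_fun setT (f i)) -> (forall i y, 0 <= f i y) ->
  (forall i, \int[P]_w (f i (Y i w))%:E = (c i)%:E)%E ->
  (\int[P]_w (\prod_(i < n) f i (Y i w))%:E = (\prod_(i < n) c i)%:E)%E.
Proof.
move=> mY iY mf f0 fc.
have gen (k : nat) (g : 'I_n -> R -> R) (a : 'I_n -> R) :
    (forall i, measurable_fun setT (g i)) -> (forall i y, 0 <= g i y) ->
    (forall i, \int[P]_w (g i (Y i w))%:E = (a i)%:E)%E ->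
    (forall i : 'I_n, (k <= i)%N -> exists2 B, measurable B & g i = \1_B) ->
    (\int[P]_w (\prod_(i < n) g i (Y i w))%:E = (\prod_(i < n) a i)%:E)%E.
  elim: k g a => [|k IH] g a mg g0 ga gi.
    have /choice[B hB] : forall i, exists B, measurable B /\ g i = \1_B.
      by move=> i; have [B mB gB] := gi i (leq0n _); exists B.
    transitivity (\int[P]_w (\1_(\bigcap_(i in [set: 'I_n]) (Y i @^-1` B i)) w)%:E)%E.
      apply: eq_integral => w _; congr EFin.
      rewrite indicE; case: (boolP (w \in _)) => [/set_mem wB|].
        by apply: big1 => i _; rewrite (hB i).2 indicE mem_set//; exact: wB.
      rewrite notin_setE => wB.
      have /existsNP[i Bi] : ~ forall i, B i (Y i w) by move=> h; apply: wB => i _.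
      by rewrite (bigD1 i)//= (hB i).2 indicE memNset// mul0r.
    have mYB i : measurable (Y i @^-1` B i).
      by rewrite -[X in measurable X]setTI; apply: mY => //; exact: (hB i).1.
    rewrite integral_indic//; last by apply: fin_bigcap_measurable.
    rewrite setIT; etransitivity; first exact: (iY B (fun i => (hB i).1)).
    rewrite -prodEFin; apply: eq_bigr => i _; rewrite -ga.
    transitivity (P ((Y i @^-1` B i) `&` setT)); first by rewrite setIT.
    rewrite -integral_indic//.
    by apply: eq_integral => w _; rewrite (hB i).2.
  have [nk|kn] := leqP n k.
    apply: IH => // i; move: (ltn_ord i) => /leq_trans /(_ nk).
    by move=> /leq_trans h /h; rewrite ltnn.
  pose k0 := Ordinal kn.
  pose F w := \prod_(i < n | i != k0) g i (Y i w).
  have mF : measurable_fun setT F.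
    apply: (eq_measurable_fun (fun w =>
      \prod_(i <- [seq i <- index_enum 'I_n | i != k0]) g i (Y i w))).
      by move=> w _; rewrite big_filter.
    by apply: measurable_prod => i _; exact: measurableT_comp.
  have F0 w : 0 <= F w by apply: prodr_ge0.
  pose A := \prod_(i < n | i != k0) a i.
  have a0 i : 0 <= a i.
    by rewrite -lee_fin -ga; apply: integral_ge0 => w _; rewrite lee_fin.
  have A0 : 0 <= A by apply: prodr_ge0.
  have EF h w : \prod_(i < n) (if i == k0 then h else g i) (Y i w) = F w * h (Y k0 w).
    rewrite (bigD1 k0)//= eqxx mulrC; congr (_ * _).
    by apply: eq_bigr => i /negbTE ->.
  transitivity (\int[P]_w (A * g k0 (Y k0 w))%:E)%E; last first.
    under eq_integral do rewrite EFinM.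
    rewrite ge0_integralZl//.
    - by rewrite ga -EFinM; congr EFin; rewrite (bigD1 k0)//= mulrC.
    - by apply/measurable_EFinP; exact: measurableT_comp.
    - by move=> w _; rewrite lee_fin.
  transitivity (\int[P]_w (F w * g k0 (Y k0 w))%:E)%E.
    by apply: eq_integral => w _; rewrite (bigD1 k0)//= mulrC.
  (* With the other factors frozen in [F], it suffices to test indicators in place of [g k0]; index
     [k] then carries an indicator too, so the induction hypothesis applies. *)
  apply: (@eq_integral_indic_ge0 R _ _ _ _ P P F (Y k0) (cst A) (Y k0) (g k0)) => //.
  move=> B mB.
  have mYB : measurable (Y k0 @^-1` B) by rewrite -[X in measurable X]setTI; exact: mY.
  pose b := fine (P (Y k0 @^-1` B)).
  have bE : (\int[P]_w (\1_B (Y k0 w))%:E = b%:E)%E.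
    rewrite /b fineK ?fin_num_measure//.
    transitivity (P ((Y k0 @^-1` B) `&` setT)); last by rewrite setIT.
    by rewrite -integral_indic.
  transitivity (A * b)%:E.
    transitivity (\int[P]_w (\prod_(i < n) (if i == k0 then \1_B else g i) (Y i w))%:E)%E.
      by apply: eq_integral => w _; rewrite EF.
    rewrite (IH (fun i => if i == k0 then \1_B else g i) (fun i => if i == k0 then b else a i)).
    - rewrite (bigD1 k0)//= eqxx mulrC; congr ((_ * _)%:E).
      by apply: eq_bigr => i /negbTE ->.
    - by move=> i; case: ifP => // _; exact: measurable_indic.
    - by move=> i y; case: ifP => // _; rewrite indicE.
    - by move=> i; case: eqP => // ->.
    - move=> i ki; case: ifPn => ik; first by exists B.
      apply: gi; rewrite ltn_neqAle ki andbT.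
      by apply: contraNneq ik => ki'; apply/eqP/val_inj.
  transitivity (\int[P]_w (A%:E * (\1_B (Y k0 w))%:E))%E; last first.
    by apply: eq_integral => w _; rewrite EFinM.
  rewrite ge0_integralZl//.
  - by rewrite bE.
  - by apply/measurable_EFinP; apply: measurableT_comp => //; exact: measurable_indic.
apply: (gen n) => // i; rewrite leqNgt => /negP; case; exact: ltn_ord.
Qed.

(** * Markov, union and Borel-Cantelli bounds *)

Lemma markov_indic (R : realType) (d : measure_display)
    (T : measurableType d) (mu : {measure set T -> \bar R})
    (A : set T) (g : T -> R) :
  measurable A -> measurable_fun setT g -> (forall w, 0 <= g w) ->
  (forall w, A w -> 1 <= g w) -> (mu A <= \int[mu]_w (g w)%:E)%E.
Proof.
move=> mA mg g0 Ag.
rewrite -[X in mu X]setIT -integral_indic//; apply: ge0_le_integral => //.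
- exact/measurable_EFinP/measurable_indic.
- exact/measurable_EFinP.
- move=> w _; rewrite lee_fin indicE; case: (boolP (w \in A)) => [/set_mem/Ag//|_].
  exact: g0.
Qed.

(** Countable subadditivity and a geometric tail sum. The factor [r ^+ m] is kept because the
    exponential estimate takes [m] proportional to time. *)
Lemma measure_bigcup_geometric (R : realType) (d : measure_display)
    (T : measurableType d) (mu : {measure set T -> \bar R})
    (F : nat -> set T) (C r : R) (m : nat) :
  (forall k, measurable (F k)) -> 0 <= C -> 0 <= r -> r < 1 ->
  (forall k, (m <= k)%N -> mu (F k) <= (C * r ^+ k)%:E)%E ->
  (mu (\bigcup_(k in [set k | (m <= k)%N]) F k) <= (C * r ^+ m / (1 - r))%:E)%E.
Proof.
move=> mF C0 r0 r1 Fle.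
have r1' : 0 < 1 - r by rewrite subr_gt0.
have geomE n : (m <= n)%N ->
    \sum_(m <= k < n) C * r ^+ k = C * (r ^+ m - r ^+ n) / (1 - r).
  elim: n => [|n IH].
    by rewrite leqn0 => /eqP ->; rewrite big_geq// subrr mulr0 mul0r.
  rewrite leq_eqVlt => /predU1P[->|]; first by rewrite big_geq// subrr mulr0 mul0r.
  rewrite ltnS => mn; rewrite big_nat_recr//= IH// exprS.
  by field; rewrite gt_eqF.
apply: (@le_trans _ _ (\sum_(m <= k <oo) mu (F k))%E).
  apply: measure_sigma_subadditive_tail => //.
    by apply: bigcup_measurable => k _.
  by move=> w [k /= mk Fw]; exists k => //; apply/negP; rewrite -leqNgt.
apply: lime_le; first by apply: is_cvg_nneseries.
near=> n.
have mn : (m <= n)%N by near: n; exact: nbhs_infty_ge.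
apply: (@le_trans _ _ (\sum_(m <= k < n) (C * r ^+ k)%:E)%E).
  by rewrite !big_nat; apply: lee_sum => k /andP[mk _]; exact: Fle.
rewrite sumEFin lee_fin geomE// ler_pM2r ?invr_gt0// ler_wpM2l//.
by rewrite lerBlDr lerDl exprn_ge0.
Unshelve. all: by end_near. Qed.

(** Borel-Cantelli: the upper limit of the [F k] lies in every tail union, whose measure tends to 0
    geometrically. *)
Lemma ae_eventually_geometric (R : realType) (d : measure_display)
    (T : measurableType d) (mu : {measure set T -> \bar R})
    (F : nat -> set T) (C r : R) :
  (forall k, measurable (F k)) -> 0 <= C -> 0 <= r -> r < 1 ->
  (forall k, mu (F k) <= (C * r ^+ k)%:E)%E ->
  {ae mu, forall w, exists m, forall k, (m <= k)%N -> ~ F k w}.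
Proof.
move=> mF C0 r0 r1 Fle.
have mL : measurable (lim_sup_set F).
  by apply: bigcap_measurable => // n _; apply: bigcup_measurable => k _.
exists (lim_sup_set F); split=> //.
  apply/eqP; rewrite -measure_le0; apply/lee_addgt0Pr => e e0; rewrite add0e.
  have r1' : 0 < 1 - r by rewrite subr_gt0.
  have cv : C / (1 - r) * r ^+ n @[n --> \oo] --> (0 : R).
    rewrite -[X in _ --> X](mulr0 (C / (1 - r))); apply: cvgM; first exact: cvg_cst.
    by apply: cvg_expr; rewrite ger0_norm.
  have [n _ /(_ n (leqnn _)) nP] : \forall n \near \oo, C / (1 - r) * r ^+ n < e.
    by move/cvgr_lt : cv; apply.
  apply: (le_trans (lim_sup_set_ub mu n mF)).
  apply: (le_trans (@measure_bigcup_geometric R d T mu F C r n mF C0 r0 r1 (fun k _ => Fle k))).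
  by rewrite lee_fin mulrAC ltW.
move=> w /= wF n _ ; apply: contrapT => h; apply: wF; exists n => k nk Fk.
by apply: h; exists k.
Qed.

(** * Exponential and Gaussian laws *)

(** Exponential tilting: [expR (th * y)] times the density of rate [l] is [l / (l - th)] times the
    density of rate [l - th], which has mass 1. *)
Lemma exponential_mgf (R : realType) (d : measure_display)
    (T : measurableType d) (P : probability T R) (Y : T -> R) (l th : R) :
  measurable_fun setT Y ->
  (forall B : set R, measurable B -> P (Y @^-1` B) = exponential_prob l B) ->
  0 < l -> th < l ->
  (\int[P]_w (expR (th * Y w))%:E = (l / (l - th))%:E)%E.
Proof.
move=> mY PY l0 thl.
have lth0 : 0 < l - th by rewrite subr_gt0.
have mexp : measurable_fun setT (fun y : R => expR (th * y)).
  by apply: measurableT_comp => //; exact: measurable_funM.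
have pdf0 (a : R) : 0 < a -> forall x, 0 <= exponential_pdf a x.
  by move=> a0 x; apply: exponential_pdf_ge0; exact: ltW.
transitivity (\int[lebesgue_measure]_y (exponential_pdf l y * expR (th * y))%:E)%E.
  transitivity (\int[P]_w (1 * expR (th * Y w))%:E)%E.
    by apply: eq_integral => w _; rewrite mul1r.
  apply: (@eq_integral_indic_ge0 R _ _ _ _ P lebesgue_measure (cst 1) Y
    (exponential_pdf l) (fun y => y) (fun y => expR (th * y))) => //.
  - exact: measurable_exponential_pdf.
  - exact: pdf0.
  - move=> B mB.
    have mYB : measurable (Y @^-1` B) by rewrite -[X in measurable X]setTI; exact: mY.
    transitivity (\int[P]_w (\1_(Y @^-1` B) w)%:E)%E.
      by apply: eq_integral => w _; rewrite /= mul1r.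
    rewrite integral_indic// setIT; etransitivity; first exact: PY.
    rewrite /exponential_prob [LHS]integral_mkcond epatch_indic.
    by apply: eq_integral => y _; rewrite EFinM.
transitivity (\int[lebesgue_measure]_y ((l / (l - th))%:E * (exponential_pdf (l - th) y)%:E))%E.
  apply: eq_integral => y _; rewrite -EFinM; congr EFin.
  have [y0|y0] := leP 0 y; last by rewrite !lt0_exponential_pdf// mul0r mulr0.
  rewrite !exponential_pdfE// mulrA divfK ?gt_eqF// -mulrA -expRD.
  by congr (_ * expR _); ring.
rewrite ge0_integralZl//.
- by rewrite integral_exponential_pdf// mule1.
- by apply/measurable_EFinP; exact: measurable_exponential_pdf.
- by move=> y _; rewrite lee_fin pdf0.
- by rewrite lee_fin divr_ge0// ltW.
Qed.

Lemma exponential_ae_ge0 (R : realType) (d : measure_display)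
    (T : measurableType d) (P : probability T R) (Y : T -> R) (l : R) :
  measurable_fun setT Y ->
  (forall B : set R, measurable B -> P (Y @^-1` B) = exponential_prob l B) ->
  {ae P, forall w, 0 <= Y w}.
Proof.
move=> mY PY; exists (Y @^-1` `]-oo, 0[); split.
- by rewrite -[X in measurable X]setTI; exact: mY.
- rewrite PY// /exponential_prob integral0_eq// => y /=.
  by rewrite in_itv/= => y0; rewrite lt0_exponential_pdf.
- by move=> w /= /negP; rewrite -ltNge in_itv.
Qed.

(** Where [m ^+ 2 <= m * y], the centred density is at most the stated exponential times the density
    centred at [m], and the latter has mass 1. Both signs of [m] are allowed, which covers both
    tails. *)
Lemma normal_prob_tail (R : realType) (m s : R) (B : set R) :
  0 < s -> measurable B -> (forall y, B y -> m ^+ 2 <= m * y) ->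
  (normal_prob 0 s B <= (expR (- m ^+ 2 / (s ^+ 2 *+ 2)))%:E)%E.
Proof.
move=> s0 mB Bm; have s0' : s != 0 by rewrite gt_eqF.
set e := expR _.
apply: (@le_trans _ _ (\int[lebesgue_measure]_(y in B) (e%:E * (normal_pdf m s y)%:E))%E).
  apply: ge0_le_integral => //.
  - by move=> y _; rewrite lee_fin normal_pdf_ge0.
  - by apply/measurable_EFinP/measurable_funTS; exact: measurable_normal_pdf.
  - apply: measurable_funeM; apply/measurable_EFinP/measurable_funTS.
    exact: measurable_normal_pdf.
  - move=> y By; rewrite -EFinM lee_fin !normal_pdfE// mulrCA.
    rewrite ler_wpM2l ?normal_peak_ge0// /normal_fun -expRD ler_expR.
    rewrite -mulrDl ler_pM2r ?invr_gt0 ?pmulrn_lgt0 ?exprn_gt0//.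
    by have := Bm _ By; nra.
rewrite ge0_integralZl//.
- rewrite -[leRHS]mule1 lee_wpmul2l ?lee_fin ?expR_ge0//.
  rewrite -(@integral_normal_pdf R m s); apply: ge0_subset_integral => //.
  + by apply/measurable_EFinP; exact: measurable_normal_pdf.
  + by move=> y _; rewrite lee_fin normal_pdf_ge0.
- by apply/measurable_EFinP/measurable_funTS; exact: measurable_normal_pdf.
- by move=> y _; rewrite lee_fin normal_pdf_ge0.
- by rewrite lee_fin expR_ge0.
Qed.

(** * Tail bounds for Wiener increments, slope sums and jump times *)

Definition slope {R : realType} (gp gm : R) (s : bool) : R :=
  if s then gp else - gm.

(* Lower bound on the drift accumulated over the first [k] sojourns when the
   drift is at least [gp] in regime + and at least [- gm] in regime -. *)
Definition slope_sum {R : realType} {Omega : Type} (tau : nat -> Omega -> R)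
  (z : bool) (gp gm : R) (k : nat) (w : Omega) : R :=
  \sum_(j < k) slope gp gm (sojourn_state z j) * tau j w.

Section wiener_and_sojourns.
Context (R : realType) (d : measure_display) (Omega : measurableType d).
Context (P : probability Omega R) (W : R -> Omega -> R) (tau : nat -> Omega -> R).
Context (z : bool) (lp lm : R).
Hypotheses (lp0 : 0 < lp) (lm0 : 0 < lm).
Hypothesis hyp : wiener_and_sojourns P W tau z lp lm.

Let rate k := leave_rate lp lm (sojourn_state z k).

Let rate_gt0 k : 0 < rate k.
Proof. by rewrite /rate /leave_rate; case: ifP. Qed.

Let mW t : measurable_fun setT (W t). Proof. by case: hyp. Qed.

Let mtau k : measurable_fun setT (tau k). Proof. by case: hyp. Qed.

(** The hypothesis speaks of strictly increasing grids starting at 0, so the grid is [0, s, t], or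
    just [0, t] when [s = 0]. *)
Lemma wiener_increment_law (s t : R) (B : set R) : 0 <= s -> s < t ->
  measurable B ->
  P ((fun w => W t w - W s w) @^-1` B) = normal_prob 0 (Num.sqrt (t - s)) B.
Proof.
move=> s0 st mB; case: hyp => _ _ _ _ h.
move: s0; rewrite le_eqVlt => /predU1P[s0|s0].
  have [] := h 1%N 0%N (nth 0 [:: 0; t]) erefl.
    by move=> [|i]//= _; rewrite s0.
  by move=> _ /(_ ord0 B mB) /=; rewrite -s0.
have [] := h 2%N 0%N (nth 0 [:: 0; s; t]) erefl.
  by move=> [|[|i]].
by move=> _ /(_ (@Ordinal 2 1 isT) B mB).
Qed.

Lemma wiener_increment_tail (s t a : R) : 0 <= s -> s < t -> 0 <= a ->
  (P [set w | (a < `|W t w - W s w|)%R] <=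
    (2 * expR (- a ^+ 2 / ((t - s) *+ 2)))%:E)%E.
Proof.
move=> s0 st a0; pose Y w := W t w - W s w.
have ts0 : 0 < t - s by rewrite subr_gt0.
have mY : measurable_fun setT Y by apply: measurable_funB; exact: mW.
have mYB B : measurable B -> measurable (Y @^-1` B).
  by move=> mB; rewrite -[X in measurable X]setTI; exact: mY.
have -> : [set w | (a < `|W t w - W s w|)%R] =
    (Y @^-1` `]a, +oo[) `|` (Y @^-1` `]-oo, (- a)%R[).
  apply/seteqP; split => w /=; rewrite !in_itv/= andbT real_ltr_normr ?num_real//.
    by rewrite ltrNr => /orP.
  by rewrite ltrNr => /orP.
(* Used with [m = a] on the right half-line and [m = - a] on the left one. *)
have tail m B : measurable B -> m ^+ 2 = a ^+ 2 -> (forall y, B y -> m ^+ 2 <= m * y) ->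
    (P (Y @^-1` B) <= (expR (- a ^+ 2 / ((t - s) *+ 2)))%:E)%E.
  move=> mB ma mBm; rewrite wiener_increment_law//.
  have := @normal_prob_tail R m (Num.sqrt (t - s)) B.
  rewrite sqrtr_gt0 => /(_ ts0 mB mBm).
  by rewrite sqr_sqrtr ?(ltW ts0)// ma.
rewrite mulrDl !mul1r EFinD; apply: le_trans (leeD _ _).
- by apply: measureU2; exact: mYB.
- apply: (tail a) => // y /=; rewrite in_itv/= andbT => ay; nra.
- apply: (tail (- a)) => //; first by rewrite sqrrN.
  move=> y /=; rewrite in_itv/= => ay; nra.
Qed.

Lemma sojourn_law (k : nat) (B : set R) : measurable B ->
  P (tau k @^-1` B) = exponential_prob (rate k) B.
Proof.
move=> mB; case: hyp => _ _ _ _ h.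
have [] // := h 0%N k.+1 (fun i => i%:R) erefl.
by move=> _ _ /(_ ord_max B mB).
Qed.

Lemma sojourns_ae_ge0 : {ae P, forall w, forall k, 0 <= tau k w}.
Proof.
apply: ae_foralln => k.
by apply: (@exponential_ae_ge0 R d Omega P (tau k) (rate k)) => // B; exact: sojourn_law.
Qed.

Lemma sojourn_mgf (m : nat) (th : nat -> R) : (forall k, th k < rate k) ->
  (\int[P]_w (expR (\sum_(k < m) th k * tau k w))%:E =
    (\prod_(k < m) (rate k / (rate k - th k)))%:E)%E.
Proof.
move=> thr; case: (hyp) => _ _ _ _ /(_ 0%N m (fun i => i%:R) erefl)[]// ind _ _.
(* With no Wiener increment in the family, every index splits to the right and [Y] is just [tau]. *)
pose Y (i : 'I_(0 + m)) := match fintype.split i with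
  | inl j => fun w => W (j.+1%:R) w - W (j%:R) w | inr k => tau k end.
have YE i : Y i = tau i.
  rewrite /Y; case: (fintype.split i) (splitK i) => [[]//|k] <- /=.
  by [].
transitivity (\int[P]_w (\prod_(i < m) expR (th i * Y i w))%:E)%E.
  apply: eq_integral => w _; rewrite expR_sum; congr EFin.
  by apply: eq_bigr => i _; rewrite YE.
apply: (@mutual_indep_expectation R d Omega P m Y (fun i y => expR (th i * y))
  (fun i => rate i / (rate i - th i))) => //.
- by move=> i; rewrite YE.
- by move=> i; apply: measurableT_comp => //; exact: measurable_funM.
- by move=> i; rewrite YE; apply: exponential_mgf => // B; exact: sojourn_law.
Qed.

Lemma measurable_slope_sum (gp gm : R) (k : nat) :
  measurable_fun setT (slope_sum tau z gp gm k).
Proof. by apply: measurable_sum => j; exact: measurable_funM. Qed.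

Lemma measurable_jump_time (k : nat) : measurable_fun setT (jump_time tau k).
Proof. exact: measurable_sum. Qed.

(** Regimes alternate, so two consecutive factors multiply to [phi true * phi false], whatever [z]
    is. The induction goes by steps of two, and the constant absorbs the unpaired factor of an odd
    product. *)
Lemma prod_sojourn_state_le (phi : bool -> R) (r : R) (k : nat) :
  (forall s, 0 < phi s) -> 0 < r -> phi true * phi false <= r ^+ 2 ->
  \prod_(j < k) phi (sojourn_state z j) <=
    (1 + phi true / r + phi false / r) * r ^+ k.
Proof.
move=> phi0 r0 phir.
have pt : 0 <= phi true / r by rewrite divr_ge0 ?ltW.
have pf : 0 <= phi false / r by rewrite divr_ge0 ?ltW.
have [n leq_kn] := ubnP k; elim: n k leq_kn => // n IH [|[|k]] leq_kn.
- by rewrite big_ord0 expr0 mulr1 -addrA lerDl addr_ge0.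
- rewrite big_ord_recl big_ord0 mulr1 expr1 !mulrDl !divfK ?gt_eqF//.
  have := phi0 true; have := phi0 false.
  by rewrite /sojourn_state/=; case: z => ? ?; lra.
- rewrite !big_ord_recl/= mulrA.
  have -> : \prod_(i < k) phi (sojourn_state z (lift ord0 (lift ord0 i))) =
      \prod_(i < k) phi (sojourn_state z i).
    by apply: eq_bigr => i _; rewrite /sojourn_state !lift0/= negbK.
  have -> : phi (sojourn_state z 0) * phi (sojourn_state z (bump 0 0)) =
      phi true * phi false.
    by rewrite /sojourn_state/=; case: z => //=; rewrite mulrC.
  rewrite -addn2 exprD mulrA [leRHS]mulrC; apply: ler_pM => //.
  + by rewrite mulr_ge0 ?ltW.
  + by apply: prodr_ge0 => i _; exact: ltW.
  + by apply: IH; exact: ltnW.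
Qed.

(** Chernoff's bound with exponent [- th]. The condition on the slopes says that a pair of sojourns
    has positive mean, so for a suitable [th > 0] its two exponential moments multiply to less than
    1. *)
Lemma slope_sum_tail (gp gm : R) : 0 < gp -> 0 < gm -> gm / lm < gp / lp ->
  exists C r del : R, [/\ 0 <= C, 0 < r < 1, 0 < del &
    forall k, (P [set w | (slope_sum tau z gp gm k w < del * k%:R)%R] <=
      (C * r ^+ k)%:E)%E].
Proof.
move=> gp0 gm0; rewrite ltr_pdivrMr// mulrAC ltr_pdivlMr// => gg.
(* [th] maximises (lp + th gp) (lm - th gm), whose value at [th = 0] is [lp lm]. *)
pose th := (gp * lm - gm * lp) / (2 * gp * gm).
have th0 : 0 < th.
  by rewrite divr_gt0 ?subr_gt0// !mulr_gt0.
have thE : th * (2 * gp * gm) = gp * lm - gm * lp.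
  by rewrite divfK// gt_eqF// !mulr_gt0.
have A1 : 0 < lp + th * gp by rewrite addr_gt0// mulr_gt0.
have A2 : 0 < lm - th * gm.
  have pl := mulr_gt0 gp0 lm0; have ml := mulr_gt0 gm0 lp0.
  have : 0 < (lm - th * gm) * (2 * gp) by lra.
  by rewrite pmulr_lgt0// mulr_gt0.
(* The exponential moment of one sojourn in regime [s], at exponent [- th] times the slope. *)
pose phi (s : bool) := if s then lp / (lp + th * gp) else lm / (lm - th * gm).
have phi0 s : 0 < phi s by rewrite /phi; case: s; rewrite divr_gt0.
set rho := phi true * phi false.
have rho0 : 0 < rho by rewrite mulr_gt0.
(* By the choice of [th], the product of the two denominators exceeds [lp * lm] by exactly
   [th ^+ 2 * gp * gm]. *)
have rho1 : rho < 1.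
  rewrite /rho /phi mulf_div ltr_pdivrMr ?mulr_gt0// mul1r.
  have p1 : 0 < th * (th * gp * gm).
    exact: (mulr_gt0 th0 (mulr_gt0 (mulr_gt0 th0 gp0) gm0)).
  have p2 : th * (th * (2 * gp * gm)) = th * (gp * lm - gm * lp) by rewrite thE.
  lra.
(* A rate per sojourn must dominate the square root of [rho]; the mean of 1 and [rho] does so and
   stays below 1. *)
pose r0 := (1 + rho) / 2.
have r00 : 0 < r0 by rewrite /r0; lra.
have r01 : r0 < 1 by rewrite /r0; lra.
have rhor : rho <= r0 ^+ 2.
  have -> : r0 ^+ 2 = rho + ((1 - rho) / 2) ^+ 2 by rewrite /r0; field.
  by rewrite lerDl sqr_ge0.
(* The gap between [r0] and [r] pays for raising the threshold from 0 to [del * k]: [del] is chosen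
   so that [expR (th * del)] equals [r / r0]. *)
pose r := (1 + r0) / 2.
have r_gt0 : 0 < r by rewrite /r; lra.
have r1 : r < 1 by rewrite /r; lra.
have rr0 : 1 < r / r0 by rewrite ltr_pdivlMr// /r; lra.
pose del := ln (r / r0) / th.
have del0 : 0 < del by rewrite divr_gt0// ln_gt0.
have edel : expR (th * del) = r / r0.
  by rewrite /del mulrC divfK ?gt_eqF// lnK// posrE (lt_trans _ rr0).
pose C := 1 + phi true / r0 + phi false / r0.
have C0 : 0 <= C.
  by rewrite /C !addr_ge0// divr_ge0// ltW.
exists C, r, del; split=> //; first by rewrite r_gt0.
move=> k.
have mS := measurable_slope_sum gp gm k.
pose e w := \sum_(j < k) (- th * slope gp gm (sojourn_state z j)) * tau j w.
have eE w : e w = - th * slope_sum tau z gp gm k w.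
  by rewrite /slope_sum mulr_sumr; apply: eq_bigr => j _; rewrite mulrA.
have me : measurable_fun setT e by apply: measurable_sum => j; exact: measurable_funM.
apply: (@le_trans _ _ (\int[P]_w (expR (th * del) ^+ k * expR (e w))%:E)%E).
  apply: markov_indic.
  - rewrite (_ : [set _ | _] = slope_sum tau z gp gm k @^-1` `]-oo, del * k%:R[).
      by rewrite -[X in measurable X]setTI; exact: mS.
    by apply/seteqP; split => w /=; rewrite in_itv.
  - by apply: measurable_funM => //; exact: measurableT_comp.
  - by move=> w; rewrite mulr_ge0 ?exprn_ge0 ?expR_ge0.
  - move=> w /= Sw; rewrite -expRM_natl -expRD -[leLHS]expR0 ler_expR eE.
    nra.
under eq_integral do rewrite EFinM.
rewrite ge0_integralZl//.
- rewrite (sojourn_mgf k (fun j => - th * slope gp gm (sojourn_state z j))); last first.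
    move=> j; rewrite /rate /slope /leave_rate; case: ifP => _; lra.
  rewrite -EFinM lee_fin edel.
  have -> : \prod_(j < k) (rate j / (rate j - - th * slope gp gm (sojourn_state z j))) =
      \prod_(j < k) phi (sojourn_state z j).
    apply: eq_bigr => j _; rewrite /rate /slope /leave_rate /phi.
    by case: ifP => _; congr (_ / _); ring.
  have -> : r ^+ k = (r / r0) ^+ k * r0 ^+ k by rewrite -exprMn divfK// gt_eqF.
  rewrite mulrCA ler_wpM2l ?exprn_ge0 ?(le_trans ler01 (ltW rr0))//.
  exact: prod_sojourn_state_le.
- by apply/measurable_EFinP; exact: measurableT_comp.
Qed.

(** Chernoff's bound again. As [a] is at most half of each rate, every sojourn contributes a factor
    at most 2, hence at most [expR 1]. *)
Lemma jump_time_tail : exists2 a : R, 0 < a &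
  forall m t, (P [set w | (t < jump_time tau m w)%R] <=
    (expR (m%:R - a * t))%:E)%E.
Proof.
pose a := Num.min lp lm / 2.
have a0 : 0 < a by rewrite divr_gt0// lt_min lp0.
have ar k : a *+ 2 <= rate k.
  rewrite -mulr_natr divfK// /rate /leave_rate ge_min.
  by case: ifP => _; rewrite lexx ?orbT.
exists a => // m t.
pose e w := \sum_(j < m) a * tau j w.
have eE w : e w = a * jump_time tau m w by rewrite /jump_time mulr_sumr.
have me : measurable_fun setT e by apply: measurable_sum => j; exact: measurable_funM.
apply: (@le_trans _ _ (\int[P]_w (expR (- (a * t)) * expR (e w))%:E)%E).
  apply: markov_indic.
  - rewrite (_ : [set _ | _] = jump_time tau m @^-1` `]t, +oo[).
      by rewrite -[X in measurable X]setTI; exact: measurable_jump_time.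
    by apply/seteqP; split => w /=; rewrite in_itv/= andbT.
  - by apply: measurable_funM => //; exact: measurableT_comp.
  - by move=> w; rewrite mulr_ge0 ?expR_ge0.
  - move=> w /= Sw; rewrite -expRD -[leLHS]expR0 ler_expR eE.
    by rewrite addrC subr_ge0 ler_pM2l// ltW.
under eq_integral do rewrite EFinM.
rewrite ge0_integralZl//.
- rewrite (sojourn_mgf m (fun=> a)); last by move=> j; have := ar j; lra.
  rewrite -EFinM lee_fin addrC expRD ler_wpM2l ?expR_ge0//.
  rewrite -[m%:R]mulr1 expRM_natl.
  rewrite -[m in leRHS]card_ord -prodr_const; apply: ler_prod => j _.
  have := ar j => aj; have raj : 0 < rate j - a by lra.
  apply/andP; split; first by rewrite divr_ge0// ltW.
  apply: (@le_trans _ _ 2); first by rewrite ler_pdivrMr//; lra.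
  by have := expR_ge1Dx (1 : R); lra.
- by apply/measurable_EFinP; exact: measurableT_comp.
Qed.

End wiener_and_sojourns.

(** * Pathwise lower bounds for the drift integral *)

Section pathwise_drift.
Context {R : realType} (f : R -> R) (M : R).
Hypothesis mf : forall t : R, 0 <= t -> measurable_fun `[0, t] f.
Hypothesis fM : forall s, `|f s| <= M.

Local Notation mu := (@lebesgue_measure R).

Let itf (t : R) : 0 <= t -> mu.-integrable `[0, t] (EFin \o f).
Proof.
move=> t0; apply: measurable_bounded_integrable => //.
- by rewrite /= lebesgue_measure_itv/=; case: ifP => _; rewrite ltry.
- exact: mf.
- exists M; split; first exact: num_real.
  by move=> N MN s _; exact: le_trans (fM s) (ltW MN).
Qed.

(** The bound on [f] stops short of [b], where the regime may switch; one point does not affect the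
    integral. *)
Lemma Rintegral_itv_slope_ge (a b s : R) : 0 <= a -> a <= b ->
  (forall y, a <= y < b -> s <= f y) ->
  \int[mu]_(y in `[0, a]) f y + s * (b - a) <= \int[mu]_(y in `[0, b]) f y.
Proof.
move=> a0 ab sf; have b0 := le_trans a0 ab.
have ifab : mu.-integrable `]a, b[ (EFin \o f).
  apply: integrableS (itf b b0) => //.
  by apply: subset_itv; rewrite bnd_simp.
rewrite addrC -lerBrDr Rintegral_itvB; [|exact: itf|by rewrite bnd_simp..].
rewrite -Rintegral_itv_bndo_bndc//.
have <- : \int[mu]_(y in `]a, b[) s = s * (b - a).
  rewrite Rintegral_cst//= lebesgue_measure_itv/= lte_fin.
  by move: ab; rewrite le_eqVlt => /predU1P[->|->//]; rewrite ltxx subrr.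
apply: le_Rintegral => //.
  apply: measurable_bounded_integrable => //.
  - by rewrite /= lebesgue_measure_itv/=; case: ifP => _; rewrite ltry.
  - exists `|s|; split; first exact: num_real.
    by move=> N MN y _; exact: ltW.
by move=> y /=; rewrite in_itv/= => /andP[ay yb]; apply: sf; rewrite (ltW ay).
Qed.

(** One segment is added per induction step. Allowing [t] to be the right end of its segment lets
    the induction hypothesis be used at the next breakpoint. *)
Lemma Rintegral_piecewise_slope_ge (u sl : nat -> R) :
  (forall j, 0 <= u j) ->
  (forall k y, \sum_(j < k) u j <= y < \sum_(j < k.+1) u j -> sl k <= f y) ->
  forall k t, \sum_(j < k) u j <= t <= \sum_(j < k.+1) u j ->
    \sum_(j < k) sl j * u j + sl k * (t - \sum_(j < k) u j) <=
    \int[mu]_(y in `[0, t]) f y.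
Proof.
move=> u0 slf k; have J0 n : 0 <= \sum_(j < n) u j by apply: sumr_ge0.
elim: k => [|k IH] t /andP[kt tk].
  have := @Rintegral_itv_slope_ge 0 t (sl 0%N) (lexx _).
  move: kt tk; rewrite !big_ord0 subr0 => t0 tk; rewrite set_itv1 Rintegral_set1.
  apply=> // y /andP[y0 yt]; apply: slf; rewrite big_ord0 y0/=.
  exact: lt_le_trans tk.
have step := @Rintegral_itv_slope_ge (\sum_(j < k.+1) u j) t (sl k.+1) (J0 _) kt.
apply: (le_trans _ (step _)); last first.
- move=> y /andP[ky yt]; apply: slf; rewrite ky/=; exact: lt_le_trans tk.
- rewrite lerD2r; apply: le_trans (IH (\sum_(j < k.+1) u j) _).
    by rewrite [X in _ * (X - _)]big_ord_recr/= [leLHS]big_ord_recr/= addrAC subrr add0r.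
  by rewrite lexx andbT big_ord_recr/= lerDl.
Qed.

End pathwise_drift.

(** The piecewise linear function is nonnegative at all jump times from the [m]-th on and affine
    between them, hence nonnegative in between. The index [k] exists because the jump times are
    unbounded. *)
Lemma slope_sum_regime_ge0 {R : realType} {Omega : Type} (tau : nat -> Omega -> R)
    (z : bool) (gp gm del : R) (m : nat) (t : R) (w : Omega) :
  (forall k, 0 <= tau k w) -> 0 < gp -> 0 < gm -> 0 < del ->
  (forall k, (m <= k)%N -> del * k%:R <= slope_sum tau z gp gm k w) ->
  jump_time tau m w <= t ->
  exists2 k, jump_time tau k w <= t <= jump_time tau k.+1 w &
     0 <= slope_sum tau z gp gm k w +
          slope gp gm (sojourn_state z k) * (t - jump_time tau k w).
Proof.
move=> tau0 gp0 gm0 del0 Sdel Jt.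
have JS k : jump_time tau k.+1 w = jump_time tau k w + tau k w.
  by rewrite /jump_time big_ord_recr.
have SS k : slope_sum tau z gp gm k.+1 w =
    slope_sum tau z gp gm k w + slope gp gm (sojourn_state z k) * tau k w.
  by rewrite /slope_sum big_ord_recr.
have Jmono : {homo jump_time tau ^~ w : a b / (a <= b)%N >-> a <= b}.
  by apply: homo_leq => [//|x y v|k]; [exact: le_trans|rewrite JS lerDl].
(* No slope exceeds [gp], so linear growth of the slope sums forces the jump times to infinity: the
   chain does not explode. *)
have SJ k : slope_sum tau z gp gm k w <= gp * jump_time tau k w.
  rewrite /slope_sum /jump_time mulr_sumr; apply: ler_sum => j _.
  by rewrite ler_wpM2r// /slope; case: ifP => _; lra.
have [k0 tk0] : exists k, t < jump_time tau k w.
  pose k := (m + (Num.truncn (gp * `|t| / del)).+1)%N; exists k.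
  have gk : gp * `|t| / del < k%:R.
    apply: (lt_le_trans (truncnS_gt _)); first by rewrite ler_nat leq_addl.
  rewrite -(ltr_pM2l gp0); apply: lt_le_trans (SJ k).
  apply: lt_le_trans (Sdel k (leq_addr _ _)).
  apply: le_lt_trans (ler_wpM2l (ltW gp0) (ler_norm t)) _.
  by rewrite [ltRHS]mulrC -ltr_pdivrMr.
(* [K] is the first jump after [t]. It exceeds [m], so the sojourn [K - 1] containing [t] has index
   at least [m]. *)
case: (ex_minnP (ex_intro (fun k => t < jump_time tau k w) k0 tk0)) => K tK Kmin.
have mK : (m < K)%N.
  rewrite ltnNge; apply/negP => /Jmono Km.
  by have := lt_le_trans tK (le_trans Km Jt); rewrite ltxx.
case: K tK Kmin mK => // k tK Kmin mk; exists k.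
  rewrite (ltW tK) andbT leNgt; apply/negP => /Kmin; by rewrite ltnn.
have kt : jump_time tau k w <= t.
  by rewrite leNgt; apply/negP => /Kmin; rewrite ltnn.
have del_ge0 j : 0 <= del * j%:R by rewrite mulr_ge0// ltW.
have S0 : 0 <= slope_sum tau z gp gm k w by apply: le_trans (Sdel k mk).
have S1 : 0 <= slope_sum tau z gp gm k.+1 w.
  by apply: le_trans (Sdel k.+1 (ltnW mk)).
move: S1; rewrite SS; move: tK; rewrite JS.
(* An affine function is smallest at the left end if its slope is nonnegative, at the right end
   otherwise. *)
set s := slope _ _ _; have [s0 _ _|s0 tK S1] := leP 0 s.
  by rewrite addr_ge0// mulr_ge0// subr_ge0.
apply: (le_trans S1); rewrite lerD2l; apply: ler_wnM2l; first exact: ltW.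
by rewrite lerBlDl ltW.
Qed.

(** * Sublinear growth of the Wiener process *)

(** Follow the left ends of the dyadic cells containing [t]: refining from level [k] to [k.+1] moves
    the left end by at most one cell, at cost [c * q ^+ k.+1]. The costs form a geometric series,
    and continuity passes from the left ends to [t]. *)
Lemma dyadic_chaining {R : realType} (f : R -> R) (T c q : R) :
  continuous f -> 0 < T -> 0 <= c -> 0 <= q -> q < 1 ->
  (forall k j, (j < 2 ^ k)%N ->
    `|f (T * j.+1%:R / 2 ^+ k) - f (T * j%:R / 2 ^+ k)| <= c * q ^+ k) ->
  forall t, 0 <= t <= T -> `|f t - f 0| <= c / (1 - q).
Proof.
move=> cf T0 c0 q0 q1 inc t /andP[t0 tT].
have q1' : 0 < 1 - q by rewrite subr_gt0.
have p2 k : 0 < 2 ^+ k :> R by rewrite exprn_gt0.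
(* The bound on the increment is the partial sum of [c * q ^+ i] for [i] up to [k]. *)
have grid k : exists2 n, (n < 2 ^ k)%N &
    T * n%:R / 2 ^+ k <= t <= T * n.+1%:R / 2 ^+ k /\
    `|f (T * n%:R / 2 ^+ k) - f 0| <= c * (1 - q ^+ k.+1) / (1 - q).
  elim: k => [|k [n nk [/andP[nt tn] fn]]].
    exists 0%N => //; rewrite mulr0 mul0r t0 mulr1 expr0 divr1 tT subrr normr0.
    by split=> //; rewrite expr1 mulfK ?gt_eqF.
  have E2 (x : R) : x / 2 ^+ k = x * 2 / 2 ^+ k.+1.
    by rewrite exprS -mulrA invfM [2 * _]mulrA divff ?mul1r.
  have En : T * n%:R / 2 ^+ k = T * (2 * n)%:R / 2 ^+ k.+1.
    by rewrite E2 natrM; congr (_ / _); ring.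
  have EnS : T * n.+1%:R / 2 ^+ k = T * (2 * n).+2%:R / 2 ^+ k.+1.
    by rewrite E2 -[(2 * n).+2](mulnS 2 n) natrM; congr (_ / _); ring.
  have qmono : c * (1 - q ^+ k.+1) / (1 - q) <= c * (1 - q ^+ k.+2) / (1 - q).
    rewrite ler_pM2r ?invr_gt0// ler_wpM2l// lerD2l lerN2 exprS.
    by rewrite ler_piMl ?exprn_ge0// ltW.
  have n2 : ((2 * n).+1 < 2 ^ k.+1)%N.
    by rewrite expnS -[(2 * n).+2](mulnS 2 n) leq_mul2l.
  have [tm|tm] := leP t (T * (2 * n).+1%:R / 2 ^+ k.+1).
    exists (2 * n)%N; first exact: ltnW.
    by rewrite -En nt tm; split => //; exact: le_trans qmono.
  exists (2 * n).+1 => //; rewrite -EnS tn (ltW tm); split=> //.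
  have -> : c * (1 - q ^+ k.+2) / (1 - q) =
      c * q ^+ k.+1 + c * (1 - q ^+ k.+1) / (1 - q).
    by rewrite [q ^+ k.+2]exprS; field; rewrite gt_eqF.
  rewrite -(subrKA (f (T * n%:R / 2 ^+ k))).
  apply: (le_trans (ler_normD _ _)); apply: lerD => //.
  by rewrite En; apply: inc; exact: ltnW.
apply/ler_addgt0Pr => e e0.
have /cvgrPdist_lt/(_ _ e0)/nbhs_ballP[eta /= eta0 feta] := cf t.
have [k kP] : exists k : nat, T / 2 ^+ k < eta.
  exists (Num.truncn (T / eta)).+1; rewrite ltr_pdivrMr//.
  rewrite -ltr_pdivrMl// [X in X < _]mulrC; apply: (lt_trans (truncnS_gt _)).
  by rewrite -natrX ltr_nat; exact: ltn_expl.
have [n nk [/andP[nt tn] fn]] := grid k.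
rewrite -(subrKA (f (T * n%:R / 2 ^+ k))) addrC.
apply: (le_trans (ler_normD _ _)); apply: lerD.
  apply: (le_trans fn); rewrite ler_pM2r ?invr_gt0// -[leRHS]mulr1 ler_wpM2l//.
  by rewrite lerBlDr lerDl exprn_ge0.
apply/ltW/feta; rewrite /ball/= ger0_norm ?subr_ge0//.
apply: le_lt_trans kP; rewrite lerBlDl; apply: (le_trans tn).
by rewrite -mulrDl -[n.+1]addn1 natrD mulrDr mulr1.
Qed.

(* Chaining over the dyadic grids of [0, 2^N]: an increment over a cell of
   length 2^(N-k) exceeds eps 2^N (9/10)^k with probability of order
   4^-N (4/5)^k 2^-k, which is summable over the 2^k cells, over k and over N. *)
Lemma wiener_ae_sublinear {R : realType} (d : measure_display)
    (Omega : measurableType d) (P : probability Omega R) (W : R -> Omega -> R)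
    (tau : nat -> Omega -> R) (z : bool) (lp lm del : R) :
  wiener_and_sojourns P W tau z lp lm -> 0 < del ->
  {ae P, forall w, exists t0, forall t, t0 <= t -> `|W t w| <= del * t}.
Proof.
move=> hyp del0; case: (hyp) => W0 cW mW _ _.
(* Chaining multiplies by [1 / (1 - q) = 10], which gives [del / 2]; the other factor 2 is lost
   between [t] and the next power of 2. *)
pose eps := del / 20.
have eps0 : 0 < eps by rewrite divr_gt0.
(* The last property bounds [1 / (2 * q ^+ 4)] by [4 / 5], so the cell probabilities remain
   geometrically summable after a union over the [2 ^ k] cells. *)
have [q [q0 q1 qE q4]] : exists q : R,
    [/\ 0 < q, q < 1, 1 - q = 1 / 10 & 1 <= 4 / 5 * (2 * q ^+ 4)].
  by exists (9 / 10); split; lra.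
pose pt N k j : R := 2 ^+ N * j%:R / 2 ^+ k.
pose A N k j := [set w | (eps * 2 ^+ N * q ^+ k < `|W (pt N k j.+1) w - W (pt N k j) w|)%R].
have p2 k : 0 < 2 ^+ k :> R by rewrite exprn_gt0.
have mA N k j : measurable (A N k j).
  have mI : measurable_fun setT (fun w => `|W (pt N k j.+1) w - W (pt N k j) w|).
    by apply: measurableT_comp => //; apply: measurable_funB; exact: mW.
  rewrite (_ : A N k j = (fun w => `|W (pt N k j.+1) w - W (pt N k j) w|) @^-1`
      `]eps * 2 ^+ N * q ^+ k, +oo[).
    by rewrite -[X in measurable X]setTI; exact: mI.
  by apply/seteqP; split => w /=; rewrite in_itv/= andbT.
pose K : R := 16 / eps ^+ 4.
have K0 : 0 < K by rewrite divr_gt0// exprn_gt0.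
have PA N k j : (P (A N k j) <= (K * (1 / 4) ^+ N * (4 / 5) ^+ k / 2 ^+ k)%:E)%E.
  have dpt : pt N k j.+1 - pt N k j = 2 ^+ N / 2 ^+ k.
    by rewrite /pt -mulrBl -mulrBr -[j.+1]addn1 natrD addrAC subrr add0r mulr1.
  have a0 : 0 <= eps * 2 ^+ N * q ^+ k by rewrite !mulr_ge0 ?exprn_ge0// ltW.
  have pt0 : 0 <= pt N k j by rewrite /pt divr_ge0 ?mulr_ge0 ?(ltW (p2 _)).
  have ptlt : pt N k j < pt N k j.+1 by rewrite -subr_gt0 dpt divr_gt0.
  apply: (le_trans (wiener_increment_tail _ _ _ _ _ _ _ _ _ hyp _ _ _ pt0 ptlt a0)).
  rewrite lee_fin dpt.
  (* The Gaussian exponent: the squared threshold divided by twice the cell length. *)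
  pose y := eps ^+ 2 / 2 * 2 ^+ N * (2 * q ^+ 2) ^+ k.
  have y0 : 0 < y by rewrite !mulr_gt0 ?exprn_gt0 ?mulr_gt0 ?invr_gt0 ?exprn_gt0.
  have -> : - (eps * 2 ^+ N * q ^+ k) ^+ 2 / (2 ^+ N / 2 ^+ k *+ 2) = - y.
    rewrite /y [(2 * q ^+ 2) ^+ k]exprMn [(q ^+ 2) ^+ k]exprAC.
    rewrite -mulr_natr; field.
    by rewrite !gt_eqF.
  (* A polynomial bound suffices: [y ^+ 2] already brings the decay in both [N] and [k]. *)
  have ey : expR (- y) <= 2 / y ^+ 2.
    rewrite expRN -[2 / _]invrK lef_pV2 ?posrE ?expR_gt0 ?invr_gt0 ?divr_gt0 ?exprn_gt0//.
    rewrite invf_div; apply: le_trans (expR_ge1Dxn 1 (ltW y0)).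
    by rewrite lerDr.
  apply: (@le_trans _ _ (2 * (2 / y ^+ 2))); first by rewrite ler_pM2l.
  have -> : 2 * (2 / y ^+ 2) = K * (1 / 4) ^+ N * ((1 / (2 * q ^+ 4)) ^+ k / 2 ^+ k).
    have -> : (1 / 4) ^+ N = 1 / (2 ^+ N) ^+ 2 :> R.
      by rewrite expr_div_n expr1n exprAC; congr (_ / _ ^+ N); ring.
    have -> : (1 / (2 * q ^+ 4)) ^+ k = 1 / (2 ^+ k * (q ^+ k) ^+ 4).
      by rewrite expr_div_n expr1n exprMn [(q ^+ k) ^+ 4]exprAC.
    have -> : y = eps ^+ 2 / 2 * 2 ^+ N * (2 ^+ k * (q ^+ k) ^+ 2).
      by rewrite /y [(2 * q ^+ 2) ^+ k]exprMn [(q ^+ k) ^+ 2]exprAC.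
    by rewrite /K; field; rewrite !gt_eqF ?exprn_gt0.
  rewrite -[leRHS]mulrA ler_wpM2l//.
    by rewrite mulr_ge0 ?exprn_ge0// ltW.
  rewrite ler_pM2r ?invr_gt0// lerXn2r ?nnegrE//.
  - by rewrite divr_ge0// mulr_ge0// exprn_ge0// ltW.
  - rewrite ler_pdivrMr; last by rewrite mulr_gt0 ?exprn_gt0.
    exact: q4.
pose E N k := \big[setU/set0]_(j < 2 ^ k) A N k j.
have mE N k : measurable (E N k) by apply: bigsetU_measurable.
have PE N k : (P (E N k) <= (K * (1 / 4) ^+ N * (4 / 5) ^+ k)%:E)%E.
  apply: (le_trans (Boole_inequality P (fun j _ => mA N k j))).
  apply: (le_trans (lee_sum _ (fun (j : 'I_(2 ^ k)) _ => PA N k j))).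
  rewrite sumEFin lee_fin sumr_const card_ord -[leLHS]mulr_natr natrX divfK ?gt_eqF//.
pose B N := \bigcup_k E N k.
have mB N : measurable (B N) by apply: bigcupT_measurable.
have PB N : (P (B N) <= (K * 5 * (1 / 4) ^+ N)%:E)%E.
  have := @measure_bigcup_geometric R d Omega P (E N) (K * (1 / 4) ^+ N) (4 / 5) 0%N (mE N).
  have -> : \bigcup_(k in [set k | (0 <= k)%N]) E N k = B N.
    by apply: eq_bigcupl; split.
  move=> /(_ _ _ _ (fun k _ => PE N k)) h; apply: (le_trans (h _ _ _)).
  - by rewrite mulr_ge0 ?exprn_ge0// ltW.
  - lra.
  - lra.
  - by rewrite lee_fin expr0 mulr1 le_eqVlt; apply/orP; left; apply/eqP; field.
have K50 : 0 <= K * 5 by rewrite mulr_ge0// ltW.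
have q40 : (0 : R) <= 1 / 4 by lra.
have q41 : (1 / 4 : R) < 1 by lra.
have := @ae_eventually_geometric R d Omega P B (K * 5) (1 / 4) mB K50 q40 q41 PB.
apply: filterS => w [m mP].
have bound N : (m <= N)%N -> forall t, 0 <= t <= 2 ^+ N -> `|W t w| <= del / 2 * 2 ^+ N.
  move=> mN t tN; rewrite -[W t w]subr0 -(W0 w).
  have -> : del / 2 * 2 ^+ N = eps * 2 ^+ N / (1 - q).
    by rewrite /eps qE; field.
  apply: (@dyadic_chaining R (fun t => W t w) (2 ^+ N)) => //.
  - by rewrite mulr_ge0 ?ltW.
  - exact: ltW.
  - move=> k j jk; rewrite leNgt; apply/negP => Aw; apply: (mP N mN).
    by exists k => //; rewrite /E -bigcup_mkord; exists j.
exists (2 ^+ m) => t mt.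
have [N0 N0P] : exists N, t <= 2 ^+ N.
  exists (Num.truncn t).+1; apply/ltW/(lt_trans (truncnS_gt _)).
  by rewrite -natrX ltr_nat; exact: ltn_expl.
have t0 : 0 <= t by apply: le_trans mt; rewrite ltW.
(* For the least such [N] beyond [m], [2 ^+ N] is at most [2 * t]. If [N <= m], the bound at level
   [m] is used with [2 ^+ m <= t]. *)
case: (ex_minnP (ex_intro (fun N => t <= 2 ^+ N) N0 N0P)) => N tN Nmin.
have [Nm|mN] := leqP N m.
  have := bound m (leqnn _) t; rewrite t0 (le_trans tN) ?ler_weXn2l ?ler1n//.
  move=> /(_ isT) /le_trans; apply; rewrite -mulrA ler_pM2l//.
  by apply: le_trans mt; have := p2 m; lra.
case: N tN Nmin mN => // N tN Nmin mN.
have := bound N.+1 (ltnW mN) t; rewrite t0 tN => /(_ isT)/le_trans; apply.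
rewrite exprS mulrA divfK// ler_pM2l// leNgt; apply/negP => /ltW/Nmin.
by rewrite ltnn.
Qed.

(** * Lower bound along a path of the equation, and assembly *)

(** In each sojourn the drift is at least the slope plus [c]. The slopes integrate to a nonnegative
    quantity by [slope_sum_regime_ge0], and [c * t] remains. *)
Lemma sde_path_ge {R : realType} {Omega : Type} (bp bm : R -> R)
    (W : R -> Omega -> R) (tau : nat -> Omega -> R) (Z : R -> Omega -> bool)
    (X : R -> Omega -> R) (x M c gp gm del : R) (z : bool) (m : nat) (t : R)
    (w : Omega) :
  (forall y, `|bp y| <= M /\ `|bm y| <= M) ->
  (forall y, gp + c <= bp y) -> (forall y, - gm + c <= bm y) ->
  0 < gp -> 0 < gm -> 0 < del ->
  chain_from_sojourns tau z Z ->
  (forall t : R, 0 <= t ->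
     measurable_fun `[0, t] (fun s : R => drift bp bm (X s w) (Z s w)) /\
     X t w = x + Rintegral lebesgue_measure `[0, t]
                   (fun s : R => drift bp bm (X s w) (Z s w)) + W t w) ->
  (forall k, 0 <= tau k w) ->
  (forall k, (m <= k)%N -> del * k%:R <= slope_sum tau z gp gm k w) ->
  jump_time tau m w <= t ->
  x + c * t + W t w <= X t w.
Proof.
move=> bM hp hm gp0 gm0 del0 chZ sde tau0 Sdel Jt.
have t0 : 0 <= t by apply: le_trans Jt; apply: sumr_ge0.
have [k kt Sk] := slope_sum_regime_ge0 _ _ _ _ _ _ _ _ tau0 gp0 gm0 del0 Sdel Jt.
have [_ ->] := sde t t0; rewrite lerD2r lerD2l.
pose f s := drift bp bm (X s w) (Z s w).
have fM s : `|f s| <= M by rewrite /f /drift; case: ifP => _; apply bM.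
pose sl k := slope gp gm (sojourn_state z k) + c.
have slf j y : \sum_(i < j) tau i w <= y < \sum_(i < j.+1) tau i w -> sl j <= f y.
  move=> /(chZ w j) Zy; rewrite /sl /f Zy /slope /drift.
  by case: (sojourn_state z j).
have := @Rintegral_piecewise_slope_ge R f M (fun t t0 => (sde t t0).1) fM
  (fun j => tau j w) sl tau0 slf k t kt.
apply: le_trans; move: Sk; rewrite /slope_sum /jump_time /sl.
set J := \sum_(j < k) tau j w; set s := slope _ _ _.
have -> : \sum_(j < k) (slope gp gm (sojourn_state z j) + c) * tau j w =
    \sum_(j < k) slope gp gm (sojourn_state z j) * tau j w + c * J.
  by rewrite mulr_sumr -big_split/=; apply: eq_bigr => j _; rewrite mulrDl.
set S := \sum_(j < k) _; move=> Sk.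
have -> : S + c * J + (s + c) * (t - J) = c * t + (S + s * (t - J)) by ring.
by rewrite lerDl.
Qed.

Theorem theorem1 (R : realType) (lp lm rp rm : R) (bp bm : R -> R)
  (d : measure_display) (Omega : measurableType d) (P : probability Omega R)
  (W : R -> Omega -> R) (tau : nat -> Omega -> R) (Z : R -> Omega -> bool)
  (X : R -> Omega -> R) (x : R) (z : bool) :
  0 < lp -> 0 < lm ->
  measurable_fun setT bp -> measurable_fun setT bm ->
  (exists M : R, forall y, `|bp y| <= M /\ `|bm y| <= M) ->
  0 < rp -> 0 < rm ->
  (forall y, rp <= bp y) -> (forall y, - rm <= bm y) ->
  rm / lm < rp / lp ->
  wiener_and_sojourns P W tau z lp lm ->
  chain_from_sojourns tau z Z ->
  solves_sde P bp bm W Z X x ->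
  [/\ {ae P, forall w, (fun t => X t w) @ +oo --> +oo},
      (exists c0 : R, 0 < c0 /\
         {ae P, forall w, forall e : R, 0 < e ->
            \forall t \near +oo, c0 - e < X t w / t}) &
      (exists c0 : R, 0 < c0 /\
         forall eps : R, 0 < eps ->
           exists kappa t0 : R, 0 < kappa < 1 /\
             forall t, t0 <= t ->
               (P [set w | ((X t w - x) / t - c0 < - eps)%R] < (kappa `^ t)%:E)%E)].
Proof.
move=> lp0 lm0 _ _ [M bM] rp0 rm0 hp hm.
rewrite ltr_pdivrMr// mulrAC ltr_pdivlMr// => rr hyp chZ [mX sde].
case: (hyp) => W0 _ mW _ _.
(* With this [c], [gp * lm - gm * lp] is exactly half of [rp * lm - rm * lp], hence still
   positive. *)
pose c := (rp * lm - rm * lp) / (2 * (lp + lm)).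
have l0 : 0 < lp + lm by rewrite addr_gt0.
have c0 : 0 < c by rewrite divr_gt0 ?subr_gt0 ?mulr_gt0.
have cE : c * (2 * (lp + lm)) = rp * lm - rm * lp.
  by rewrite divfK// gt_eqF// mulr_gt0.
have clp := mulr_gt0 c0 lp0; have clm := mulr_gt0 c0 lm0.
have rmlp := mulr_gt0 rm0 lp0.
pose gp := rp - c; pose gm := rm + c.
have gp0 : 0 < gp.
  by rewrite -(pmulr_lgt0 _ lm0) /gp; lra.
have gm0 : 0 < gm by rewrite addr_gt0.
have gg : gm / lm < gp / lp.
  by rewrite ltr_pdivrMr// mulrAC ltr_pdivlMr// /gm /gp; lra.
have hp' y : gp + c <= bp y by rewrite /gp subrK.
have hm' y : - gm + c <= bm y by rewrite /gm opprD subrK.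
have [C [r [del [C0 /andP[r0 r1] del0 Stail]]]] :=
  slope_sum_tail _ _ _ _ _ _ _ _ _ lp0 lm0 hyp gp gm gp0 gm0 gg.
pose F k := [set w | (slope_sum tau z gp gm k w < del * k%:R)%R].
have mF k : measurable (F k).
  rewrite (_ : F k = slope_sum tau z gp gm k @^-1` `]-oo, del * k%:R[).
    rewrite -[X in measurable X]setTI.
    by apply: (measurable_slope_sum _ _ _ _ _ _ _ _ _ hyp gp gm k).
  by apply/seteqP; split => w /=; rewrite in_itv.
have notF k w : ~ F k w -> del * k%:R <= slope_sum tau z gp gm k w.
  by move=> /negP; rewrite -leNgt.
have tau_ge0 := sojourns_ae_ge0 _ _ _ _ _ _ _ _ _ hyp.
pose sde_at w := forall t : R, 0 <= t ->
  measurable_fun `[0, t] (fun s : R => drift bp bm (X s w) (Z s w)) /\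
  X t w = x + Rintegral lebesgue_measure `[0, t]
                (fun s : R => drift bp bm (X s w) (Z s w)) + W t w.
have good : {ae P, forall w, sde_at w /\ forall k, 0 <= tau k w}.
  by move: sde tau_ge0; apply: filterS2.
have c20 : 0 < c / 2 by rewrite divr_gt0.
(* Eventually the Wiener term takes away at most half of [c * t]. The first two claims follow from
   this bound. *)
have lower : {ae P, forall w, exists T, forall t, T <= t -> x + c / 2 * t <= X t w}.
  have BC := ae_eventually_geometric R d Omega P F C r mF C0 (ltW r0) r1 Stail.
  have WS := wiener_ae_sublinear _ _ P _ _ _ _ _ _ hyp c20.
  move: good BC WS; apply: filterS3 => w [sdew tauw] [m mP] [t0 Wt].
  exists (Num.max (jump_time tau m w) t0) => t; rewrite ge_max => /andP[Jt tt].
  have := sde_path_ge bp bm W tau Z X x M c gp gm del z m t w bM hp' hm' gp0 gm0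
    del0 chZ sdew tauw (fun k mk => notF k w (mP k mk)) Jt.
  by have := Wt t tt; rewrite ler_norml => /andP[]; lra.
split.
- move: lower; apply: filterS => w [T TP]; apply/cvgryPge => A; near=> t.
  have tT : T <= t by near: t; apply: nbhs_pinfty_ge; exact: num_real.
  have tA : (A - x) / (c / 2) <= t by near: t; apply: nbhs_pinfty_ge; exact: num_real.
  by apply: le_trans (TP t tT); rewrite -lerBlDl mulrC -ler_pdivrMr.
- exists (c / 2); split => //; move: lower; apply: filterS => w [T TP] e e0; near=> t.
  have tT : T <= t by near: t; apply: nbhs_pinfty_ge; exact: num_real.
  have t0 : 0 < t by near: t; apply: nbhs_pinfty_gt; exact: num_real.
  (* From then on [- x < e * t], so the starting point is absorbed by [e]. *)
  have te : - x / e < t by near: t; apply: nbhs_pinfty_gt; exact: num_real.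
  rewrite ltr_pdivlMr//; apply: lt_le_trans (TP t tT).
  by move: te; rewrite ltr_pdivrMr//; lra.
have [a a0 Jtail] := jump_time_tail _ _ _ _ _ _ _ _ _ lp0 lm0 hyp.
(* The exceptional paths are put into a measurable null set [N] that can join the union bound. *)
case: good => N [mN PN0 goodN].
(* With [m] about [al * t], three failures compete: a late [m]-th jump (rate [al]), a small slope
   sum after it (rate [g2], from [r ^+ m]), and a Wiener value beyond [c / 2 * t] in size (rate
   [g3]). The worst rate is [g], and [K] adds up the constants. *)
pose al := a / 2.
have al0 : 0 < al by rewrite divr_gt0.
pose g2 := - (al * ln r).
have g20 : 0 < g2 by rewrite oppr_gt0 pmulr_rlt0// ln_lt0// r0.
pose g3 := c ^+ 2 / 8.
have g30 : 0 < g3 by rewrite divr_gt0// exprn_gt0.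
pose g := Num.min al (Num.min g2 g3).
have g0 : 0 < g by rewrite !lt_min al0 g20.
have gal : g <= al by rewrite ge_min lexx.
have gg2 : g <= g2 by rewrite !ge_min lexx orbT.
have gg3 : g <= g3 by rewrite !ge_min lexx !orbT.
pose K := expR 1 + C / (1 - r) + 2.
have r1' : 0 < 1 - r by rewrite subr_gt0.
have Cr : 0 <= C / (1 - r) by rewrite divr_ge0// ltW.
have K0 : 0 < K by rewrite /K; have := expR_gt0 (1 : R); lra.
have mXlt (t u : R) : measurable [set w | ((X t w - x) / t < u)%R].
  have mY : measurable_fun setT (fun w => (X t w - x) / t).
    by apply: measurable_funM => //; apply: measurable_funB.
  rewrite (_ : [set w | _] = (fun w => (X t w - x) / t) @^-1` `]-oo, u[).
    by rewrite -[X in measurable X]setTI; exact: mY.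
  by apply/seteqP; split => w /=; rewrite in_itv.
have main t : 0 < t ->
    (P [set w | ((X t w - x) / t < c / 2)%R] <= (K * expR (- (g * t)))%:E)%E.
  move=> t0; set D := [set w | _].
  have mD : measurable D by exact: mXlt.
  pose m := (Num.truncn (al * t)).+1.
  have mt : al * t < m%:R by apply: truncnS_gt.
  have mt1 : m%:R <= al * t + 1.
    by rewrite -[m]addn1 natrD lerD2r truncn_le// mulr_ge0 ?ltW.
  pose A1 := [set w | (t < jump_time tau m w)%R].
  pose A2 := \bigcup_(k in [set k | (m <= k)%N]) F k.
  pose A3 := [set w | (c / 2 * t < `|W t w - W 0 w|)%R].
  have mA1 : measurable A1.
    rewrite (_ : A1 = jump_time tau m @^-1` `]t, +oo[).
      rewrite -[X in measurable X]setTI.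
      by apply: (measurable_jump_time _ _ _ _ _ _ _ _ _ hyp m).
    by apply/seteqP; split => w /=; rewrite in_itv/= andbT.
  have mA2 : measurable A2 by apply: bigcup_measurable.
  have mA3 : measurable A3.
    have mY : measurable_fun setT (fun w => `|W t w - W 0 w|).
      by apply: measurableT_comp => //; apply: measurable_funB.
    rewrite (_ : A3 = (fun w => `|W t w - W 0 w|) @^-1` `]c / 2 * t, +oo[).
      by rewrite -[X in measurable X]setTI; exact: mY.
    by apply/seteqP; split => w /=; rewrite in_itv/= andbT.
  (* Off these sets [sde_path_ge] gives [X t w >= x + c / 2 * t], which contradicts [D]. *)
  have DA : D `<=` N `|` (A1 `|` (A2 `|` A3)).
    move=> w Dw; apply: contrapT => /not_orP[nN /not_orP[nA1 /not_orP[nA2 nA3]]].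
    have [sdew tauw] : sde_at w /\ forall k, 0 <= tau k w.
      by apply: contrapT => bad; apply: nN; exact: goodN.
    have Jt : jump_time tau m w <= t by rewrite leNgt; apply/negP.
    have Sk k : (m <= k)%N -> del * k%:R <= slope_sum tau z gp gm k w.
      by move=> mk; apply: notF => Fk; apply: nA2; exists k.
    have := sde_path_ge bp bm W tau Z X x M c gp gm del z m t w bM hp' hm' gp0 gm0
      del0 chZ sdew tauw Sk Jt.
    move: nA3; rewrite /A3/= W0 subr0 => /negP; rewrite -leNgt ler_norml => /andP[].
    by move: Dw; rewrite /D/= ltr_pdivrMr//; lra.
  have PA1 : (P A1 <= (expR 1 * expR (- (g * t)))%:E)%E.
    apply: (le_trans (Jtail m t)); rewrite lee_fin -expRD ler_expR.
    have : g * t <= al * t by rewrite ler_pM2r.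
    by move: mt1; rewrite /al; lra.
  have PA2 : (P A2 <= (C / (1 - r) * expR (- (g * t)))%:E)%E.
    apply: (le_trans (measure_bigcup_geometric R d Omega P F C r m mF C0 (ltW r0) r1
      (fun k _ => Stail k))).
    rewrite lee_fin mulrAC ler_wpM2l// -[r in r ^+ m]lnK ?posrE// -expRM_natl ler_expR.
    have : g * t <= g2 * t by rewrite ler_pM2r.
    have : m%:R * ln r <= al * t * ln r by rewrite ler_nM2r ?ltW// ln_lt0// r0.
    by rewrite /g2; lra.
  have PA3 : (P A3 <= (2 * expR (- (g * t)))%:E)%E.
    have ct : 0 <= c / 2 * t by rewrite mulr_ge0 ?ltW.
    apply: (le_trans (wiener_increment_tail _ _ _ _ _ _ _ _ _ hyp _ _ _ (lexx 0) t0 ct)).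
    rewrite lee_fin ler_pM2l// ler_expR subr0.
    have -> : - (c / 2 * t) ^+ 2 / (t *+ 2) = - (g3 * t).
      by rewrite /g3 -mulr_natr; field; rewrite gt_eqF.
    by rewrite lerN2 ler_pM2r.
  apply: (@le_trans _ _ (P (N `|` (A1 `|` (A2 `|` A3))))).
    by apply: le_measure; rewrite ?inE//; do 3 apply: measurableU => //.
  apply: (le_trans (measureU2 P mN _)); first by do 2 apply: measurableU => //.
  rewrite -[leRHS]add0e; apply: leeD.
    by rewrite le_eqVlt; apply/orP; left; apply/eqP; exact: PN0.
  apply: (le_trans (measureU2 P mA1 (measurableU _ _ mA2 mA3))).
  rewrite 2!mulrDl -addrA EFinD; apply: leeD; first exact: PA1.
  by apply: (le_trans (measureU2 P mA2 mA3)); rewrite EFinD; exact: leeD.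
exists (c / 2); split=> // eps eps0.
(* Half of the rate [g] is given up to absorb [K]: for [t] at least [2 * K / g],
   [K < 1 + g * t / 2 <= expR (g * t / 2)]. The bound holds even without the margin [eps], so
   neither constant depends on it. *)
exists (expR (- (g / 2))), (2 * K / g); split.
  by rewrite expR_gt0 expR_lt1 oppr_lt0 divr_gt0.
move=> t tt; have t0 : 0 < t by apply: lt_le_trans tt; rewrite divr_gt0 ?mulr_gt0.
have -> : [set w | ((X t w - x) / t - c / 2 < - eps)%R] =
    [set w | ((X t w - x) / t < c / 2 - eps)%R].
  by apply/seteqP; split => w /=; lra.
apply: (@le_lt_trans _ _ (P [set w | ((X t w - x) / t < c / 2)%R])).
  by apply: le_measure; rewrite ?inE; [exact: mXlt..|move=> w /=; lra].
apply: (le_lt_trans (main t t0)).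
rewrite lte_fin -expRM -ltr_pdivlMr ?expR_gt0// -expRN -expRD.
have -> : - (g / 2) * t - - (g * t) = g * t / 2 by field.
apply: lt_le_trans (expR_ge1Dx _).
by move: tt; rewrite ler_pdivrMr//; lra.
Unshelve. all: by end_near.
Qed.
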